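(* Let $0\le\mu<L<\infty$, let $K\ge1$ be an integer, and let $\mathcal{A}$ be a fixed-step first-order method with step sizes $\{\eta_k^i\}$ such that $\eta_k^k\neq0$ for $k=0,\dots,K-1$. Let $\mathcal{Z}\subset\mathbf{S}_+^{K+2}\times\mathbf{R}^{K+1}$ be the lifted set for $\mathcal{F}_{\mu,L}$ (see context), let $\hat Z_i=(\hat G_i,\hat F_i)$, $i=1,\dots,N$, be i.i.d. samples from $\mathbf{P}_Z$, and let the performance metric be $\phi^K(G,F)=\langle(A_{\rm obj},b_{\rm obj}),(G,F)\rangle$ with $A_{\rm obj}\in\mathbf{S}^{K+2}$, $b_{\rm obj}\in\mathbf{R}^{K+1}$. Let $\beta\in(0,1)$ and let $\varepsilon=\varepsilon_N(\beta)>0$ be a radius satisfying $$\mathbf{P}_Z^N\big(W(\mathbf{P}_Z,\hat{\mathbf{P}}_Z)\le\varepsilon\big)\ge1-\beta.$$ Then with probability at least $1-\beta$ (over the samples) the following hold, where (DRO-PEP) is the conic minimization problem defined in the context. (Expectation) The average-case performance $\mathbf{E}_{Z\sim\mathbf{P}_Z}\big(\phi^K(Z)\big)$ is upper-bounded by the optimal value of (DRO-PEP) with $J=1$ and $(A_{\rm obj}^1,b_{\rm obj}^1,c_{\rm obj}^1)=(A_{\rm obj},b_{\rm obj},0)$ (the case $\alpha=1$). (CVaR) For $\alpha\in(0,1]$, the performance $\mathbf{CVaR}_\alpha(\phi^K(Z))$ with $Z\sim\mathbf{P}_Z$ is upper-bounded by the optimal value of (DRO-PEP) with $J=2$, $(A_{\rm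 obj}^1,b_{\rm obj}^1,c_{\rm obj}^1)=\alpha^{-1}(A_{\rm obj},b_{\rm obj},\alpha-1)$ and $(A_{\rm obj}^2,b_{\rm obj}^2,c_{\rm obj}^2)=(0,0,1)$.
   Context: Notation: $\mathbf{S}^n$ ($\mathbf{S}^n_+$) is the space of symmetric (positive semidefinite) $n\times n$ matrices. On $\mathbf{S}^{K+2}\times\mathbf{R}^{K+1}$, $\langle(X,Y),(G,F)\rangle=\mathrm{tr}(X^TG)+Y^TF$ and $\|(G,F)\|=\sqrt{\|G\|_F^2+\|F\|_2^2}$ ($\|\cdot\|_F$ Frobenius); its dual norm $\|\cdot\|_*$ is the same norm. $\mathbf{CVaR}_\alpha(X)=\inf_{t\in\mathbf{R}}(t+\alpha^{-1}\mathbf{E}(X-t)_+)$. Fixed-step first-order method: $x^{k+1}=x^k-\sum_{i=0}^k\eta_k^i g^i$, $g^i=\nabla f(x^i)$, with scalars $\eta_k^i$ fixed independently of the instance $(f,x^0)$. Instances: pairs $(f,x^0)$ with $f:\mathbf{R}^d\to\mathbf{R}$ in $\mathcal{F}_{\mu,L}$ (differentiable, $L$-Lipschitz gradient, $\mu$-strongly convex; convex if $\mu=0$), normalized so that $x^\star=0$ is a minimizer and $f^\star=f(x^\star)=0$, and with $\|x^0-x^\star\|^2\le r^2$ ($r>0$ fixed). The large-scale regime $d\ge K+2$ is assumed. Lifting: with $f^k=f(x^k)$, $P=[\,x^0-x^\star\ \ g^0\ \cdots\ g^K\,]\in\mathbf{R}^{d\times(K+2)}$, the lift of $(f,x^0)$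 is $Z=(G,F)$ with $G=P^TP\in\mathbf{S}_+^{K+2}$ and $F=(f^0-f^\star,\dots,f^K-f^\star)\in\mathbf{R}^{K+1}$. Lifted set: let $\mathcal{I}=\{\star,0,\dots,K\}$ and $M=\{(p,q)\in\mathcal{I}\times\mathcal{I}: p\ne q\}$. The interpolation conditions of $\mathcal{F}_{\mu,L}$ are, for all $(p,q)\in M$, $$f^p\ge f^q+\langle g^q,x^p-x^q\rangle+\tfrac{1}{2(1-\mu/L)}\Big(\tfrac1L\|g^p-g^q\|^2+\mu\|x^p-x^q\|^2-\tfrac{2\mu}{L}\langle g^q-g^p,x^q-x^p\rangle\Big),$$ where $x^\star=g^\star=0$, $f^\star=0$ and $x^k=x^0-\sum_{l<k}\sum_{i\le l}\eta_l^ig^i$. Since each $x^k,g^k$ is a fixed linear combination of the columns of $P$, each condition can be written as $\langle(A_m,b_m),(G,F)\rangle\le0$ with $A_m\in\mathbf{S}^{K+2}$, $b_m\in\mathbf{R}^{K+1}$, $m=(p,q)$. The initial condition $\|x^0-x^\star\|^2\le r^2$ is written as $\langle(A_0,b_0),(G,F)\rangle+c_0\le0$ (i.e. $A_0=e_1e_1^T$, $b_0=0$, $c_0=-r^2$). Then $$\mathcal{Z}=\{(G,F)\in\mathbf{S}_+^{K+2}\times\mathbf{R}^{K+1}:\langle(A_m,b_m),(G,F)\rangle\le0\ \forall m\in M,\ \langle(A_0,b_0),(G,F)\rangle+c_0\le0\}.$$ Distributions: $\mathbf{P}_Z$ is a probability distribution on $\mathcal{Z}$, the pushforward under lifting of a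 distribution $\mathbf{P}$ of instances $(f,x^0)$. $\hat{\mathbf{P}}_Z=\frac1N\sum_{i=1}^N\delta_{\hat Z_i}$, and $W$ is the $1$-Wasserstein distance on probability measures on $\mathcal{Z}$ with ground cost $\|Z_1-Z_2\|$. (DRO-PEP), for given $J$ and $(A_{\rm obj}^j,b_{\rm obj}^j,c_{\rm obj}^j)_{j=1}^J$ and radius $\varepsilon$: $$\begin{array}{ll}\text{minimize}&\frac1N\sum_{i=1}^Ns_i\\ \text{subject to}&c_{\rm obj}^jt-c_0\tau_i^j-\langle(X_i^j,Y_i^j),(\hat G_i,\hat F_i)\rangle+\lambda\varepsilon\le s_i,\\ &\sum_{m\in M}(y_i^j)_m(A_m,b_m)-(X_i^j,Y_i^j)+\tau_i^j(A_0,b_0)-(A_{\rm obj}^j,b_{\rm obj}^j)\in\mathbf{S}_+^{K+2}\times\{0\},\\ &\|(X_i^j,Y_i^j)\|_*\le\lambda,\qquad i=1,\dots,N,\ j=1,\dots,J,\end{array}$$ with variables $s_i\in\mathbf{R}$, $t\in\mathbf{R}$, $\tau_i^j\in\mathbf{R}_+$, $(X_i^j,Y_i^j)\in\mathbf{S}^{K+2}\times\mathbf{R}^{K+1}$, $\lambda\in\mathbf{R}_+$, $y_i^j\in\mathbf{R}_+^{|M|}$. *)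

(* Defs.v *)
From HB Require Import structures.
From mathcomp Require Import all_boot all_order all_algebra.
From mathcomp Require Import all_classical all_reals all_analysis.
Set Implicit Arguments.
Unset Strict Implicit.
Unset Printing Implicit Defensive.
Import Order.TTheory GRing.Theory Num.Theory.
Import numFieldNormedType.Exports.
Local Open Scope classical_set_scope.
Local Open Scope ring_scope.

(* The library norm on matrices is the sup norm, hence [enorm]; both norms
   give the same topology and the same notion of differentiability. *)

Definition dot (R : realType) (d : nat) (u v : 'cV[R]_d) : R := (u^T *m v) 0 0.

Definition enorm (R : realType) (d : nat) (u : 'cV[R]_d) : R :=
  Num.sqrt (dot u u).

Definition grad (R : realType) (d : nat) (f : 'cV[R]_d -> R) (x : 'cV[R]_d) :
    'cV[R]_d :=
  \col_(i < d) 'D_(delta_mx i 0) f x.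

Record smooth_convex (R : realType) (d : nat) (mu L : R)
    (f : 'cV[R]_d -> R) : Prop := {
  sc_differentiable : forall x, differentiable f x;
  sc_lipschitz : forall x y, enorm (grad f x - grad f y) <= L * enorm (x - y);
  sc_convex : forall (x y : 'cV[R]_d) (t : R), 0 <= t -> t <= 1 ->
    f (t *: x + (1 - t) *: y) <=
    t * f x + (1 - t) * f y - mu / 2 * (t * (1 - t)) * enorm (x - y) ^+ 2 }.

Record is_instance (R : realType) (d : nat) (mu L r : R)
    (f : 'cV[R]_d -> R) (x0 : 'cV[R]_d) : Prop := {
  inst_class : smooth_convex mu L f;
  inst_min : forall x, f 0 <= f x;
  inst_fstar : f 0 = 0;
  inst_init : enorm (x0 - 0) ^+ 2 <= r ^+ 2 }.

(* [eta k i] is the step size eta_k^i. *)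

Section Method.
Variables (R : realType) (d : nat) (eta : nat -> nat -> R).
Variables (f : 'cV[R]_d -> R) (x0 : 'cV[R]_d).

(* [trace k j] is x^(min j k): the recursion needs the whole history. *)
Fixpoint trace (k : nat) : nat -> 'cV[R]_d :=
  if k is k'.+1 then fun j =>
    if (j <= k')%N then trace k' j
    else trace k' k' - \sum_(i < k'.+1) eta k' i *: grad f (trace k' i)
  else fun=> x0.

Definition iterate (k : nat) : 'cV[R]_d := trace k k.

Lemma trace_iterate k j : (j <= k)%N -> trace k j = iterate j.
Proof.
elim: k => [|k IH]; first by rewrite leqn0 => /eqP ->.
rewrite leq_eqVlt => /predU1P[-> //|]; rewrite ltnS => jk /=.
by rewrite jk IH.
Qed.

Lemma iterate0 : iterate 0 = x0. Proof. by []. Qed.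

Lemma iterateS k :
  iterate k.+1 =
  iterate k - \sum_(i < k.+1) eta k i *: grad f (iterate i).
Proof.
rewrite {1}/iterate /= ltnn; congr (_ - _); apply: eq_bigr => i _.
by rewrite trace_iterate // -ltnS.
Qed.

End Method.

(* The first component is a general square matrix; symmetry is imposed
   explicitly wherever S^{K+2} is meant. *)

Definition lifted (R : realType) (K : nat) : Type :=
  ('M[R]_K.+2 * 'cV[R]_K.+1)%type.

HB.instance Definition _ (R : realType) (K : nat) :=
  GRing.Lmodule.copy (lifted R K) ('M[R]_K.+2 * 'cV[R]_K.+1)%type.

HB.instance Definition _ (R : realType) (K : nat) :=
  Measurable.copy (lifted R K)
    (g_sigma_algebraType (@open ('M[R]_K.+2 * 'cV[R]_K.+1)%type)).

Section Lifted.
Variables (R : realType) (K : nat).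
Implicit Types (Z : lifted R K).

Definition linner Z1 Z2 : R := \tr (Z1.1^T *m Z2.1) + dot Z1.2 Z2.2.

Definition lnorm Z : R :=
  Num.sqrt (\sum_i \sum_j Z.1 i j ^+ 2 + \sum_i Z.2 i 0 ^+ 2).

Definition sym_mx n (A : 'M[R]_n) : Prop := A^T = A.

Definition psd_mx n (A : 'M[R]_n) : Prop :=
  sym_mx A /\ forall v : 'cV[R]_n, 0 <= (v^T *m A *m v) 0 0.

End Lifted.

Section Lift.
Variables (R : realType) (d K : nat) (eta : nat -> nat -> R).
Variables (f : 'cV[R]_d -> R) (x0 : 'cV[R]_d).

Definition Pmat : 'M[R]_(d, K.+2) :=
  \matrix_(i < d, j < K.+2)
    (if j is Ordinal k.+1 _ then grad f (iterate eta f x0 k) else x0 - 0) i 0.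

Definition pep_lift : lifted R K :=
  (Pmat^T *m Pmat, \col_(k < K.+1) (f (iterate eta f x0 k) - f 0)).

End Lift.
Arguments pep_lift {R d} K eta f x0.

(* [None] stands for the index star. *)

Notation pepI K := (option 'I_K.+1).

Notation pepM K := {m : pepI K * pepI K | m.1 != m.2}.

Section Interpolation.
Variables (R : realType) (K : nat) (mu L r : R) (eta : nat -> nat -> R).

(* x^p = P (xvec p), g^p = P (gvec p), f^p - f^star = F^T (fvec p) *)
Definition gvec (p : pepI K) : 'cV[R]_K.+2 :=
  if p is Some k then delta_mx (inord k.+1) 0 else 0.

Definition xvec (p : pepI K) : 'cV[R]_K.+2 :=
  if p is Some k then
    delta_mx ord0 0 -
    \sum_(l < k) \sum_(i < l.+1) eta l i *: gvec (Some (inord i))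
  else 0.

Definition fvec (p : pepI K) : 'cV[R]_K.+1 :=
  if p is Some k then delta_mx k 0 else 0.

(* Symmetrized so that tr ((sprod u v)^T P^T P) = <P u, P v>. *)
Definition sprod (u v : 'cV[R]_K.+2) : 'M[R]_K.+2 :=
  2^-1 *: (u *m v^T + v *m u^T).

(* The interpolation inequality for (p,q), with everything moved to the
   right-hand side and rewritten in terms of G = P^T P and F. *)
Definition interp_coef (m : pepI K * pepI K) : lifted R K :=
  let: (p, q) := m in
  (sprod (gvec q) (xvec p - xvec q) +
   (2 * (1 - mu / L))^-1 *:
     (L^-1 *: sprod (gvec p - gvec q) (gvec p - gvec q)
      + mu *: sprod (xvec p - xvec q) (xvec p - xvec q)
      - (2 * mu / L) *: sprod (gvec q - gvec p) (xvec q - xvec p)),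
   fvec q - fvec p).

Definition init_coef : lifted R K := (delta_mx ord0 ord0, 0).
Definition init_const : R := - r ^+ 2.

Definition lifted_set : set (lifted R K) :=
  [set Z | [/\ psd_mx Z.1,
     forall m : pepM K, linner (interp_coef (val m)) Z <= 0 &
     linner init_coef Z + init_const <= 0]].

End Interpolation.

(* For measurable [A] this is [p%:E <= Q A]; otherwise inner probability. *)
Definition prob_ge d (T : measurableType d) (R : realType)
    (Q : probability T R) (p : R) (A : set T) : Prop :=
  exists E, [/\ measurable E, E `<=` A & (p%:E <= Q E)%E].

(* Taking some of the [A i] equal to [setT] gives both the marginal laws and
   the product rule over subfamilies. *)
Definition iid_samples d (T : measurableType d) d' (O : measurableType d')
    (R : realType) (Q : probability O R) (P : probability T R) (N : nat)
    (X : 'I_N -> O -> T) : Prop :=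
  (forall i, measurable_fun setT (X i)) /\
  (forall A : 'I_N -> set T, (forall i, measurable (A i)) ->
    Q (\bigcap_(i in [set: 'I_N]) (X i @^-1` A i)) = (\prod_(i < N) P (A i))%E).

Definition empirical d (T : measurableType d) (R : realType) (N : nat)
    (x : 'I_N -> T) (A : set T) : \bar R :=
  ((N%:R^-1)%:E * \sum_(i < N) \d_(x i) A)%E.

Arguments empirical {d T R N} x A.

Definition coupling d (T : measurableType d) (R : realType)
    (P1 P2 : set T -> \bar R) (pi : probability (T * T)%type R) : Prop :=
  forall A, measurable A -> pi (fst @^-1` A) = P1 A /\ pi (snd @^-1` A) = P2 A.

(* A coupling of two measures carried by a set S is carried by S x S, so for
   measures on [lifted_set] couplings need no support condition. *)
Definition wasserstein (R : realType) (K : nat)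
    (P1 P2 : set (lifted R K) -> \bar R) : \bar R :=
  ereal_inf [set (\int[pi]_z (lnorm (z.1 - z.2))%:E)%E |
             pi in [set pi | coupling P1 P2 pi]].

Definition CVaR d (T : measurableType d) (R : realType)
    (P : probability T R) (alpha : R) (X : T -> R) : \bar R :=
  ereal_inf [set (t%:E + (alpha^-1)%:E *
                  'E_P[fun z => (Num.max (X z - t) 0)%R])%E | t in [set: R]].

Section DROPEP.
Variables (R : realType) (K N J : nat) (mu L r : R) (eta : nat -> nat -> R).
(* (A_obj^j, b_obj^j) and c_obj^j *)
Variables (obj : 'I_J -> lifted R K) (cobj : 'I_J -> R).
Variables (eps : R) (Zhat : 'I_N -> lifted R K).

Record dro_vars := DroVars {
  dv_s : 'I_N -> R;
  dv_t : R;
  dv_tau : 'I_N -> 'I_J -> R;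
  dv_XY : 'I_N -> 'I_J -> lifted R K;
  dv_lambda : R;
  dv_y : 'I_N -> 'I_J -> pepM K -> R }.

Definition dro_slack (v : dro_vars) (i : 'I_N) (j : 'I_J) : lifted R K :=
  \sum_(m : pepM K) dv_y v i j m *: interp_coef mu L eta (val m)
  - dv_XY v i j + dv_tau v i j *: init_coef R K - obj j.

(* The dual norm of [lnorm] is [lnorm] itself. *)
Record dro_feasible (v : dro_vars) : Prop := {
  dro_epi : forall i j,
    cobj j * dv_t v - init_const r * dv_tau v i j
    - linner (dv_XY v i j) (Zhat i) + dv_lambda v * eps <= dv_s v i;
  dro_cone : forall i j,
    psd_mx (dro_slack v i j).1 /\ (dro_slack v i j).2 = 0;
  dro_norm : forall i j, lnorm (dv_XY v i j) <= dv_lambda v;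
  dro_sym : forall i j, sym_mx (dv_XY v i j).1;
  dro_tau_ge0 : forall i j, 0 <= dv_tau v i j;
  dro_lambda_ge0 : 0 <= dv_lambda v;
  dro_y_ge0 : forall i j m, 0 <= dv_y v i j m }.

(* +oo when infeasible *)
Definition dro_value : \bar R :=
  ereal_inf [set (N%:R^-1 * \sum_(i < N) dv_s v i)%:E | v in dro_feasible].

End DROPEP.

(* Main.v *)
Require Import Defs.
From HB Require Import structures.
From mathcomp Require Import all_boot all_order all_algebra.
From mathcomp Require Import all_classical all_reals all_analysis.
From mathcomp Require Import measurable_realfun.
From mathcomp Require Import ring lra.
Set Implicit Arguments.
Unset Strict Implicit.
Unset Printing Implicit Defensive.
Import Order.TTheory GRing.Theory Num.Theory.
Import numFieldNormedType.Exports.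
Local Open Scope classical_set_scope.
Local Open Scope ring_scope.

(** The conic program is the Lagrangian dual of the worst case of the objective
    over the Wasserstein ball, and an upper bound only takes weak duality.

    Fix a feasible point [v] and a lifted point [Z].  Pairing the conic
    constraint with [Z] gives
      <obj_j, Z> = sum_m y_m <A_m, Z> + tau <A_0, Z> - <X, Z> - <slack, Z>,
    where the interpolation terms are nonpositive, the initial condition
    bounds the second term by [- c_0 tau], and the slack term is the pairing of
    two positive semidefinite matrices.  By Cauchy-Schwarz, replacing [Z] by a
    sample [Zhat i] in <X, Z> costs at most [lambda * lnorm (Z - Zhat i)].
    With the epigraph constraint, this is [dro_weak_duality]:
      c_j t + <obj_j, Z> <= s_i + lambda (lnorm (Z - Zhat i) - eps)
    for all [i] and [j].  Integrating such a bound against a coupling of [PZ]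
    and the empirical law turns the right-hand side into the mean of the [s_i]
    plus [lambda] times (transport cost - eps) ([transport_bound]); couplings
    of cost arbitrarily close to [eps] exist when the Wasserstein distance is at
    most [eps] ([wasserstein_ball_bound]).  Hence the bound holds on the very
    event on which the radius is valid.

    For CVaR the two pieces are [t + alpha^-1 (phi - t)] and [t], whose maximum
    is the integrand [t + alpha^-1 (phi - t)_+] of the variational formula,
    evaluated at the [t] of the feasible point.

    The nonnegativity of the slack term is obtained for almost every [Z]:
    by the pushforward hypothesis, [PZ] is carried by Gram matrices [P^T P], for
    which tr (S P^T P) is a sum of quadratic forms of [S] over the rows of [P].
    The set of all [Z] pairing nonnegatively with the semidefinite cone
    ([psd_dual]) is closed, hence measurable, and contains every lift. *)

(** * The Euclidean space of lifted points *)

Section LiftedSpace.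
Variables (R : realType) (K : nat).
Implicit Types (W Z : lifted R K).

Lemma linnerE W Z :
  linner W Z = \sum_i \sum_j W.1 j i * Z.1 j i + \sum_i W.2 i 0 * Z.2 i 0.
Proof.
rewrite /linner /dot mxE; congr (_ + _).
  by apply: eq_bigr => i _; rewrite mxE; apply: eq_bigr => j _; rewrite mxE.
by apply: eq_bigr => i _; rewrite mxE.
Qed.

Lemma linnerC W Z : linner W Z = linner Z W.
Proof.
rewrite !linnerE; congr (_ + _); last by apply: eq_bigr => i _; rewrite mulrC.
by apply: eq_bigr => i _; apply: eq_bigr => j _; rewrite mulrC.
Qed.

Lemma linnerDr W Z1 Z2 : linner W (Z1 + Z2) = linner W Z1 + linner W Z2.
Proof.
rewrite !linnerE addrACA -!big_split /=; congr (_ + _).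
  apply: eq_bigr => i _; rewrite -big_split /=; apply: eq_bigr => j _.
  by rewrite mxE mulrDr.
by apply: eq_bigr => i _; rewrite mxE mulrDr.
Qed.

Lemma linnerZr W a Z : linner W (a *: Z) = a * linner W Z.
Proof.
rewrite !linnerE mulrDr !mulr_sumr; congr (_ + _).
  apply: eq_bigr => i _; rewrite mulr_sumr; apply: eq_bigr => j _.
  by rewrite mxE mulrCA.
by apply: eq_bigr => i _; rewrite mxE mulrCA.
Qed.

Lemma linnerNr W Z : linner W (- Z) = - linner W Z.
Proof. by rewrite -scaleN1r linnerZr mulN1r. Qed.

Lemma linnerBr W Z1 Z2 : linner W (Z1 - Z2) = linner W Z1 - linner W Z2.
Proof. by rewrite linnerDr linnerNr. Qed.

Lemma linnerDl W1 W2 Z : linner (W1 + W2) Z = linner W1 Z + linner W2 Z.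
Proof. by rewrite linnerC linnerDr !(linnerC Z). Qed.

Lemma linnerZl a W Z : linner (a *: W) Z = a * linner W Z.
Proof. by rewrite linnerC linnerZr linnerC. Qed.

Lemma linnerNl W Z : linner (- W) Z = - linner W Z.
Proof. by rewrite -scaleN1r linnerZl mulN1r. Qed.

Lemma linnerBl W1 W2 Z : linner (W1 - W2) Z = linner W1 Z - linner W2 Z.
Proof. by rewrite linnerC linnerBr !(linnerC Z). Qed.

Lemma linner0l Z : linner 0 Z = 0.
Proof. by rewrite -(scale0r (0 : lifted R K)) linnerZl mul0r. Qed.

Lemma linner_suml (J : finType) (F : J -> lifted R K) Z :
  linner (\sum_j F j) Z = \sum_j linner (F j) Z.
Proof.
by elim/big_rec2: _ => [|j y x _ IH]; rewrite ?linner0l // linnerDl IH.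
Qed.

Lemma linner_ge0 Z : 0 <= linner Z Z.
Proof.
rewrite linnerE addr_ge0 //; apply: sumr_ge0 => i _; last exact: sqr_ge0.
by apply: sumr_ge0 => j _; exact: sqr_ge0.
Qed.

Lemma lnormE Z : lnorm Z = Num.sqrt (linner Z Z).
Proof.
by rewrite /lnorm linnerE exchange_big.
Qed.

(** Cauchy-Schwarz, through the discriminant of the nonnegative quadratic
    [x |-> linner (x *: W + Z) (x *: W + Z)]. *)
Lemma linner_le_lnorm W Z : linner W Z <= lnorm W * lnorm Z.
Proof.
pose p : {poly R} := Poly [:: linner Z Z; 2 * linner W Z; linner W W].
have p_ge0 x : 0 <= p.[x].
  have := linner_ge0 (x *: W + Z).
  rewrite linnerDl !linnerDr !linnerZl !linnerZr (linnerC Z W) horner_Poly /=.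
  by congr (_ <= _); ring.
have szp : (size p <= 3)%N by exact: size_Poly.
have := deg_le2_poly_ge0 szp p_ge0; rewrite !coef_Poly /= => disc.
rewrite !lnormE -sqrtrM ?linner_ge0 //.
apply: le_trans (ler_norm _) _; rewrite -sqrtr_sqr ler_wsqrtr //.
by move: disc; lra.
Qed.

Lemma linner_continuous W :
  continuous (linner W : 'M[R]_K.+2 * 'cV[R]_K.+1 -> R).
Proof.
have -> : linner W = fun Z =>
    \sum_i \sum_j W.1 j i * Z.1 j i + \sum_i W.2 i 0 * Z.2 i 0.
  by apply/funext => Z; rewrite linnerE.
have coord1 j i :
    continuous (fun Z : 'M[R]_K.+2 * 'cV[R]_K.+1 => W.1 j i * Z.1 j i).
  case=> A v; apply: cvgM; first exact: cvg_cst.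
  apply: (@cvg_comp _ _ _ fst (fun M : 'M[R]_(K.+2) => M j i)) cvg_fst _.
  exact: coord_continuous.
have coord2 i :
    continuous (fun Z : 'M[R]_K.+2 * 'cV[R]_K.+1 => W.2 i 0 * Z.2 i 0).
  case=> A v; apply: cvgM; first exact: cvg_cst.
  apply: (@cvg_comp _ _ _ snd (fun M : 'cV[R]_(K.+1) => M i 0)) cvg_snd _.
  exact: coord_continuous.
move=> Z; apply: cvgD.
  apply: (continuous_big (op := +%R)) => [|i _]; first exact: add_continuous.
  apply: (continuous_big (op := +%R)) => [|j _]; first exact: add_continuous.
  exact: coord1.
apply: (continuous_big (op := +%R)) => [|i _]; first exact: add_continuous.
exact: coord2.
Qed.

(** The sigma-algebra of [lifted] is generated by the open sets of the
    underlying product, whose topology is not attached to [lifted] itself. *)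
Lemma closed_measurable_lifted (A : set (lifted R K)) :
  closed (A : set ('M[R]_K.+2 * 'cV[R]_K.+1)%type) -> measurable A.
Proof.
move=> /closed_openC oA; rewrite -(setCK A); apply: measurableC.
exact: sub_sigma_algebra.
Qed.

Lemma closed_halfspace W c :
  closed ([set Z | linner W Z <= c] : set ('M[R]_K.+2 * 'cV[R]_K.+1)%type).
Proof.
apply: (@preimage_closed _ _ (linner W) [set x : R | x <= c]).
  by move=> Z _; exact: linner_continuous.
exact: closed_le.
Qed.

Lemma measurable_linner W : measurable_fun [set: lifted R K] (linner W).
Proof.
apply: (measurability _ (RGenOInfty.measurableE R)) => _ [_ [c ->] <-].
rewrite setTI -setCitvl preimage_setC; apply: measurableC.
apply: closed_measurable_lifted.
rewrite [X in closed X](_ : _ = [set Z | linner W Z <= c]).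
  exact: closed_halfspace.
by apply/seteqP; split => Z /=; rewrite in_itv.
Qed.
End LiftedSpace.

(** * Integration against couplings with an empirical law *)

(** The integral is the difference of the integrals of the positive and the
    negative parts, each monotone on its own; so [f] may fail to be
    integrable. *)
Lemma ae_le_integral_measurable d (T : measurableType d) (R : realType)
    (mu : {measure set T -> \bar R})
    (f g : T -> \bar R) :
  measurable_fun setT f -> measurable_fun setT g ->
  {ae mu, forall x, (f x <= g x)%E} ->
  (\int[mu]_x f x <= \int[mu]_x g x)%E.
Proof.
move=> mf mg fg; rewrite integralE [leRHS]integralE leeB //.
  apply: ae_ge0_le_integral => //; try exact: measurable_funepos.
  apply: filterS fg => x fgx _.
  apply: (@funepos_le _ _ [set x] f g); rewrite ?inE //.
  by move=> y; rewrite inE => ->.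
apply: ae_ge0_le_integral => //; try exact: measurable_funeneg.
apply: filterS fg => x fgx _.
apply: (@funeneg_le _ _ [set x] f g); rewrite ?inE //.
by move=> y; rewrite inE => ->.
Qed.

Lemma probability_setI1 d (T : measurableType d) (R : realType)
    (P : probability T R) (A B : set T) :
  measurable A -> measurable B -> P A = 1%E -> P B = 1%E -> P (A `&` B) = 1%E.
Proof.
move=> mA mB PA1 PB1.
have diff0 : P (A `\` B) = 0%E.
  apply: (subset_measure0 _ (measurableC mB)); first exact: measurableD.
    exact: subDsetr.
  by apply: etrans (probability_setC P mB) _; rewrite PB1 subee.
rewrite -[LHS]add0e -PA1 -diff0; apply/esym.
exact: (measureDI P mA mB).
Qed.

Section Transport.
Context d (T : measurableType d) (R : realType).

Lemma coupling_integral_fst (P1 : probability T R) (P2 : set T -> \bar R)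
    (pi : probability (T * T)%type R) (g : T -> \bar R) :
  coupling P1 P2 pi -> measurable_fun setT g ->
  (\int[P1]_z g z = \int[pi]_z g z.1)%E.
Proof.
move=> pi12 mg.
have pushE (h : T -> \bar R) : measurable_fun setT h ->
    (forall z, 0 <= h z)%E ->
    (\int[P1]_z h z = \int[pi]_z (h \o fst) z)%E.
  move=> mh h0.
  rewrite -[RHS](ge0_integral_pushforward measurable_fst pi measurableT mh) //.
  by apply: eq_measure_integral => A mA _; exact/esym/(pi12 A mA).1.
rewrite -[RHS]/(\int[pi]_z (g \o fst) z)%E.
rewrite integralE [RHS]integralE (funepos_comp g fst) (funeneg_comp g fst) !pushE //.
- exact: measurable_funeneg.
- exact: measurable_funepos.
Qed.

Variables (N : nat) (x : 'I_N -> T).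

Lemma empirical_fin (A : set T) :
  empirical x A = (N%:R^-1 * \sum_k \1_A (x k) : R)%:E.
Proof. by rewrite /empirical EFinM -sumEFin. Qed.

Lemma coupling_empirical_integral (P1 : set T -> \bar R)
    (pi : probability (T * T)%type R) (b : 'I_N -> R) :
  (forall i, measurable [set x i]) -> coupling P1 (empirical x) pi ->
  let h z := \sum_i b i * \1_[set x i] z in
  pi.-integrable setT (fun z => (h z.2)%:E) /\
  (\int[pi]_z (h z.2)%:E = (N%:R^-1 * \sum_k h (x k))%:E)%E.
Proof.
move=> mx pi12 h.
have msnd i : measurable (snd @^-1` [set x i] : set (T * T)).
  by rewrite -[X in measurable X]setTI; exact: measurable_snd.
have hE : (fun z : T * T => (h z.2)%:E) =
    fun z => (\sum_i (b i)%:E * (\1_(snd @^-1` [set x i]) z)%:E)%E.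
  by apply/funext => z; rewrite /h -sumEFin.
have int_i i : pi.-integrable setT
    (fun z => (b i)%:E * (\1_(snd @^-1` [set x i]) z)%:E)%E.
  by apply: integrableZl => //; exact: integrable_indic.
rewrite hE; split; first exact: integrable_sum.
rewrite integral_sum //.
have intE i : (\int[pi]_z ((b i)%:E * (\1_(snd @^-1` [set x i]) z)%:E))%E =
    (N%:R^-1 * (b i * \sum_k \1_[set x i] (x k)))%:E.
  rewrite integralZl //; last exact: integrable_indic.
  rewrite integral_indic // setIT mulrCA EFinM -empirical_fin.
  by congr (_ * _)%E; exact: (pi12 _ (mx i)).2.
under eq_bigr do rewrite intE.
rewrite sumEFin -mulr_sumr exchange_big /=; congr (_ * _)%:E.
by under eq_bigr => i _ do rewrite mulr_sumr; rewrite exchange_big.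
Qed.

(** Weak duality for transport to an empirical law.  Almost surely the second
    coordinate of the coupling is a sample point, so the pointwise bound
    integrates once the constants [a i] are carried by a function [h] of that
    coordinate. *)
Lemma transport_bound (P : probability T R) (pi : probability (T * T)%type R)
    (D : set T) (g : T -> R) (c : T * T -> R) (a : 'I_N -> R) (lam kappa : R) :
  (forall i, measurable [set x i]) ->
  (0 < N)%N -> coupling P (empirical x) pi -> measurable D -> P D = 1%E ->
  measurable_fun setT g -> measurable_fun setT c ->
  (forall z, 0 <= c z) -> 0 <= lam ->
  (forall z i, D z -> g z <= a i + lam * c (z, x i)) ->
  (\int[pi]_z (c z)%:E <= kappa%:E)%E ->
  (\int[P]_z (g z)%:E <= (N%:R^-1 * \sum_i a i + lam * kappa)%:E)%E.
Proof.
move=> mx N_gt0 pi12 mD PD1 mg mc c_ge0 lam_ge0 g_le c_le.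
(* Sample points may coincide, so [a] need not factor through [x]: [h] averages
   [a] over the indices sharing a sample point, which leaves its mean
   unchanged. *)
pose mult z : R := \sum_k \1_[set x k] z.
pose h z := \sum_i (a i / mult (x i)) * \1_[set x i] z.
have mult_gt0 i : 0 < mult (x i).
  rewrite /mult (bigD1 i) //= ltr_pwDl //; first by rewrite indicE mem_set.
  by apply: sumr_ge0 => k _.
have avg k : \sum_i (mult (x i))^-1 * \1_[set x i] (x k) = 1 :> R.
  rewrite -[RHS](mulVf (lt0r_neq0 (mult_gt0 k))) {3}/mult mulr_sumr.
  apply: eq_bigr => i _; rewrite indicE.
  by case: (boolP (_ \in _)) => [/set_mem/= ->//|]; rewrite !mulr0.
have hsum : \sum_k h (x k) = \sum_i a i.
  rewrite exchange_big /=; apply: eq_bigr => i _.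
  rewrite -mulr_sumr -[RHS]mulr1 -mulrA; congr (_ * _).
  rewrite (_ : \sum_k _ = mult (x i)) ?mulVf ?lt0r_neq0 //.
  apply: eq_bigr => k _; rewrite !indicE; congr (_%:R).
  by congr nat_of_bool; apply/idP/idP => /set_mem/= e; apply/mem_set.
have [int_h intE] := coupling_empirical_integral
  (fun i => a i / mult (x i)) mx pi12.
rewrite -/h in int_h intE.
have int_c : pi.-integrable setT (EFin \o c).
  apply/integrableP; split; first exact/measurable_EFinP.
  under eq_integral => z _ do rewrite /= ger0_norm//.
  exact: le_lt_trans c_le (ltry _).
have int_lc : pi.-integrable setT (fun z => lam%:E * (c z)%:E)%E.
  exact: integrableZl.
rewrite (coupling_integral_fst (g := EFin \o g) pi12); last first.
  exact/measurable_EFinP.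
apply: (@le_trans _ _ (\int[pi]_z ((h z.2)%:E + lam%:E * (c z)%:E))%E); last first.
  rewrite integralD // integralZl // intE hsum EFinD leeD2l // EFinM.
  by rewrite lee_wpmul2l // lee_fin.
apply: ae_le_integral_measurable.
- by apply/measurable_EFinP; apply: measurableT_comp.
- by apply: emeasurable_funD; [case/integrableP: int_h|case/integrableP: int_lc].
have ae_prob1 (A : set (T * T)) : measurable A -> pi A = 1%E ->
    {ae pi, forall z, A z}.
  move=> mA piA; exists (~` A); split => //; first exact: measurableC.
  by rewrite probability_setC // piA subee.
have ae1 : {ae pi, forall z, D z.1}.
  apply: (ae_prob1 (fst @^-1` D)); last by rewrite -PD1; exact: (pi12 D mD).1.
  by rewrite -[X in measurable X]setTI; exact: measurable_fst.
have mX : measurable (\bigcup_i [set x i]).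
  by apply: fin_bigcup_measurable => //; exact: finite_finset.
have ae2 : {ae pi, forall z, (\bigcup_i [set x i]) z.2}.
  apply: (ae_prob1 (snd @^-1` (\bigcup_i [set x i]))).
    by rewrite -[X in measurable X]setTI; exact: measurable_snd.
  apply: etrans; first exact: (pi12 _ mX).2.
  rewrite empirical_fin (eq_bigr (fun=> 1)) => [|k _].
    by rewrite sumr_const card_ord mulVf // pnatr_eq0 -lt0n.
  by rewrite indicE mem_set //; exists k.
apply: filterS2 ae1 ae2 => -[z1 z2] /= Dz [k _ /= zk]; subst z2.
(* With the cost moved to the left, that side is below each [a i] with
   [x i = x k], hence below their average. *)
rewrite -EFinM -EFinD lee_fin -lerBlDr -[leLHS]mulr1 -(avg k) mulr_sumr.
apply: ler_sum => i _; rewrite indicE.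
case: (boolP (_ \in _)) => [/set_mem/= xki|_]; last by rewrite !mulr0.
rewrite !mulr1; apply: ler_wpM2r; first by rewrite invr_ge0 ltW.
by rewrite lerBlDr xki; exact: g_le.
Qed.
End Transport.

(** * Measurability of the lifted set and of the ground cost *)

Section Cone.
Variables (R : realType) (K : nat).
Implicit Types (Z : lifted R K).

Lemma linner_delta1 i j Z : linner ((delta_mx i j, 0) : lifted R K) Z = Z.1 i j.
Proof.
rewrite linnerE /= [X in _ + X]big1 ?addr0 => [|k _]; last by rewrite mxE mul0r.
rewrite (bigD1 j) //= (bigD1 i) //= mxE !eqxx mul1r !big1 ?addr0 //.
  move=> l lj; rewrite big1 // => k _.
  by rewrite mxE (negPf lj) andbF mul0r.
by move=> k ki; rewrite mxE (negPf ki) mul0r.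
Qed.

Lemma linner_delta2 i Z : linner ((0, delta_mx i 0) : lifted R K) Z = Z.2 i 0.
Proof.
rewrite linnerE /= big1 ?add0r => [|k _]; last first.
  by rewrite big1 // => l _; rewrite mxE mul0r.
rewrite (bigD1 i) //= mxE !eqxx mul1r big1 ?addr0 // => k ki.
by rewrite mxE (negPf ki) mul0r.
Qed.

Lemma linner_rank1 (v : 'cV[R]_K.+2) Z :
  linner ((v *m v^T, 0) : lifted R K) Z = (v^T *m Z.1 *m v) 0 0.
Proof.
rewrite /linner /= trmx_mul trmxK -[in LHS]mulmxA mxtrace_mulC /dot trmx0 mul0mx.
by rewrite [X in _ + X]mxE addr0 /mxtrace big_ord1.
Qed.

(** Cylinder over the dual cone of the semidefinite cone. *)
Definition psd_dual : set (lifted R K) :=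
  [set Z | forall S : 'M[R]_K.+2, psd_mx S -> 0 <= linner ((S, 0) : lifted R K) Z].

Lemma measurable_psd_dual : measurable psd_dual.
Proof.
apply: closed_measurable_lifted.
rewrite [X in closed X](_ : _ = \bigcap_(S in [set S | @psd_mx R _ S])
    [set Z | linner (- (S, 0) : lifted R K) Z <= 0]).
  by apply: closed_bigI => S _; exact: closed_halfspace.
by apply/seteqP; split => Z HZ S /HZ /=; rewrite linnerNl oppr_le0.
Qed.

Lemma gram_psd_dual d (P : 'M[R]_(d, K.+2)) F : psd_dual (P^T *m P, F).
Proof.
move=> S [Ssym S_ge0]; rewrite /linner /= Ssym /dot trmx0 mul0mx mxE addr0.
rewrite mulmxA mxtrace_mulC mulmxA; apply: sumr_ge0 => i _.
have := S_ge0 (row i P)^T; rewrite trmxK -row_mul.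
by rewrite !mxE; congr (_ <= _); apply: eq_bigr => j _; rewrite !mxE.
Qed.

(** Symmetry, the quadratic forms, interpolation and the initial condition
    are all closed half-spaces for the pairing [linner]. *)
Lemma measurable_lifted_set mu L r eta : measurable (@lifted_set R K mu L r eta).
Proof.
apply: closed_measurable_lifted.
pose H W c : set ('M[R]_K.+2 * 'cV[R]_K.+1) := [set Z | linner W Z <= c].
rewrite [X in closed X](_ : _ =
    (\bigcap_(p in [set: 'I_K.+2 * 'I_K.+2])
        H ((delta_mx p.1 p.2, 0) - (delta_mx p.2 p.1, 0)) 0) `&`
    (\bigcap_(v in [set: 'cV[R]_K.+2]) H (- (v *m v^T, 0)) 0) `&`
    (\bigcap_(m in [set: pepM K]) H (interp_coef mu L eta (val m)) 0) `&`
    H (init_coef R K) (- init_const r)).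
  repeat apply: closedI; try (apply: closed_bigI => ? _); exact: closed_halfspace.
apply/seteqP; split=> Z.
  case=> -[Zsym Zpsd] Zint Zinit; split; last by rewrite /H /= -subr_le0 opprK.
  split; last by move=> m _; exact: Zint.
  split=> [[i j] _|v _].
    rewrite /H /= linnerBl !linner_delta1 /=.
    by rewrite -[in X in X - _]Zsym mxE subrr.
  by rewrite /H /= linnerNl linner_rank1 oppr_le0.
case=> -[[Zsym Zpsd] Zint] Zinit; split.
- split.
    apply/matrixP => i j; rewrite mxE; apply/eqP; rewrite eq_le.
    have := Zsym (i, j) I; have := Zsym (j, i) I.
    by rewrite /H /= !linnerBl !linner_delta1 !subr_le0 => -> ->.
  by move=> v; have := Zpsd v I; rewrite /H /= linnerNl linner_rank1 oppr_le0.
- by move=> m; exact: Zint.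
by move: Zinit; rewrite /H /= -subr_le0 opprK.
Qed.

(** Measurability is for the product of the two sigma-algebras, not for the Borel
    sets of the product space, so it is derived coordinate by coordinate. *)
Lemma measurable_lnorm_diff :
  measurable_fun [set: lifted R K * lifted R K] (fun z => lnorm (z.1 - z.2)).
Proof.
have mcoord W : measurable_fun [set: lifted R K * lifted R K]
    (fun z => linner W (z.1 - z.2) ^+ 2).
  apply: measurable_funX.
  rewrite (_ : (fun z => _) = fun z => linner W z.1 - linner W z.2); last first.
    by apply/funext => z; rewrite linnerBr.
  by apply: measurable_funB; apply: measurableT_comp => //; exact: measurable_linner.
rewrite (_ : (fun z => _) = fun z => Num.sqrt
   (\sum_i \sum_j linner ((delta_mx i j, 0) : lifted R K) (z.1 - z.2) ^+ 2 +
    \sum_i linner ((0, delta_mx i 0) : lifted R K) (z.1 - z.2) ^+ 2)).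
  apply: measurableT_comp.
    by apply: continuous_measurable_fun; exact: sqrt_continuous.
  apply: measurable_funD; apply: measurable_sum => i //.
  by apply: measurable_sum => j.
apply/funext => z; rewrite /lnorm; congr (Num.sqrt (_ + _)).
  by apply: eq_bigr => i _; apply: eq_bigr => j _; rewrite linner_delta1.
by apply: eq_bigr => i _; rewrite linner_delta2.
Qed.
End Cone.

(** * Weak duality *)

Lemma mean_shift (R : numFieldType) N (a : 'I_N -> R) (b : R) :
  (0 < N)%N -> N%:R^-1 * \sum_i (a i + b) = N%:R^-1 * \sum_i a i + b.
Proof.
move=> N_gt0; rewrite big_split /= sumr_const card_ord mulrDr; congr (_ + _).
by rewrite -(mulr_natl b) mulKf // pnatr_eq0 -lt0n.
Qed.

Section Duality.
Variables (R : realType) (K N : nat).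
Variables (mu L r : R) (eta : nat -> nat -> R).

(** The pairing of the conic constraint with a lifted point; the dual norm
    constraint pays for moving from the sample to that point. *)
Lemma dro_weak_duality J (obj : 'I_J -> lifted R K) (cobj : 'I_J -> R) (eps : R)
    (Zhat : 'I_N -> lifted R K) (v : dro_vars R K N J) (Z : lifted R K) i j :
  dro_feasible mu L r eta obj cobj eps Zhat v ->
  lifted_set mu L r eta Z -> psd_dual Z ->
  cobj j * dv_t v + linner (obj j) Z <=
    dv_s v i + dv_lambda v * (lnorm (Z - Zhat i) - eps).
Proof.
move=> [epi cone norm _ tau_ge0 lam_ge0 y_ge0] [_ Zint Zinit] Zdual.
have [slack_psd slack2] := cone i j.
have slack_ge0 : 0 <= linner (dro_slack mu L eta obj v i j) Z.
  by have := Zdual _ slack_psd; rewrite -slack2 -surjective_pairing.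
have int_le0 : \sum_(m : pepM K)
    dv_y v i j m * linner (interp_coef mu L eta (val m)) Z <= 0.
  by apply: sumr_le0 => m _; rewrite mulr_ge0_le0.
have init_le : dv_tau v i j * (linner (init_coef R K) Z + init_const r) <= 0.
  by rewrite mulr_ge0_le0.
have dist_le : - linner (dv_XY v i j) (Z - Zhat i) <=
    dv_lambda v * lnorm (Z - Zhat i).
  rewrite -linnerNl; apply: le_trans (linner_le_lnorm _ _) _.
  apply: ler_wpM2r; first exact: sqrtr_ge0.
  by rewrite lnormE linnerNl linnerC linnerNl opprK -lnormE.
move: slack_ge0 (epi i j); rewrite /dro_slack.
rewrite linnerBl linnerDl linnerBl linnerZl linner_suml.
rewrite (eq_bigr (fun m : pepM K =>
  dv_y v i j m * linner (interp_coef mu L eta (val m)) Z)) => [|m _]; last first.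
  by rewrite linnerZl.
by move: int_le0 init_le dist_le; rewrite linnerBr; lra.
Qed.

(** The radius bounds an infimum over couplings, so for every [del > 0] some
    coupling costs less than [eps + del]; the excess [lam * del] in the bound
    is then made arbitrarily small. *)
Lemma wasserstein_ball_bound (PZ : probability (lifted R K) R)
    (Zhat : 'I_N -> lifted R K) (D : set (lifted R K)) (g : lifted R K -> R)
    (a : 'I_N -> R) (lam eps : R) :
  (0 < N)%N ->
  (wasserstein PZ (empirical Zhat) <= eps%:E)%E ->
  measurable D -> PZ D = 1%E -> measurable_fun setT g -> 0 <= lam ->
  (forall Z i, D Z -> g Z <= a i + lam * (lnorm (Z - Zhat i) - eps)) ->
  (\int[PZ]_Z (g Z)%:E <= (N%:R^-1 * \sum_i a i)%:E)%E.
Proof.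
move=> N_gt0 W_le mD PD1 mg lam_ge0 g_le; apply/lee_addgt0Pr => e e_gt0.
(* Adding 1 covers [lam = 0]. *)
pose del := e / (lam + 1).
have del_gt0 : 0 < del by rewrite divr_gt0 // ltr_wpDl.
have [_ [pi pi12 <-] pi_lt] :
    exists2 y, [set \int[pi]_z (lnorm (z.1 - z.2))%:E | pi in
      [set pi | coupling PZ (empirical Zhat) pi]]%E y & (y < (eps + del)%:E)%E.
  by apply: ereal_inf_lt; apply: le_lt_trans W_le _; rewrite lte_fin ltrDl.
have mZhat i : measurable [set Zhat i].
  apply: closed_measurable_lifted; apply: accessible_closed_set1.
  apply: hausdorff_accessible; exact: norm_hausdorff.
have bound : (\int[PZ]_Z (g Z)%:E <=
    (N%:R^-1 * \sum_i (a i - lam * eps) + lam * (eps + del))%:E)%E.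
  apply: (transport_bound mZhat N_gt0 pi12 mD PD1 mg
    (@measurable_lnorm_diff R K) (fun z => sqrtr_ge0 _) lam_ge0 _ (ltW pi_lt)).
  by move=> Z i /(g_le Z i); rewrite mulrBr addrCA addrC.
apply: le_trans bound _.
have lam_del : lam * del <= e.
  rewrite /del mulrCA ger_pMr // ler_pdivrMr ?mul1r ?lerDl //.
  exact: ltr_wpDl.
by rewrite -EFinD lee_fin mean_shift //; move: lam_del; lra.
Qed.
End Duality.

(** * The performance bounds *)

Theorem corollary2p1 (R : realType) (mu L r : R) (K d N : nat)
    (eta : nat -> nat -> R)
    (mu_ge0 : 0 <= mu) (mu_lt_L : mu < L) (r_gt0 : 0 < r)
    (K_ge1 : (1 <= K)%N) (large_scale : (K + 2 <= d)%N) (N_ge1 : (1 <= N)%N)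
    (eta_neq0 : forall k, (k < K)%N -> eta k k != 0)
    (* the distribution of instances: the law of a random instance (f, x0) *)
    (dI : measure_display) (I : measurableType dI) (P : probability I R)
    (f : I -> 'cV[R]_d -> R) (x0 : I -> 'cV[R]_d)
    (instances : forall w, is_instance mu L r (f w) (x0 w))
    (lift_measurable :
      measurable_fun [set: I] (fun w => pep_lift K eta (f w) (x0 w)))
    (* its pushforward, a distribution on the lifted set *)
    (PZ : probability (lifted R K) R)
    (PZ_on_Z : PZ (lifted_set mu L r eta) = 1%E)
    (PZ_pushforward : forall A : set (lifted R K), measurable A ->
      PZ A = P ((fun w => pep_lift K eta (f w) (x0 w)) @^-1` A))
    (dO : measure_display) (O : measurableType dO) (Q : probability O R)
    (Zhat : 'I_N -> O -> lifted R K)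
    (samples : iid_samples Q PZ Zhat)
    (Aobj : 'M[R]_K.+2) (bobj : 'cV[R]_K.+1) (Aobj_sym : sym_mx Aobj)
    (beta eps : R) (beta_gt0 : 0 < beta) (beta_lt1 : beta < 1)
    (eps_gt0 : 0 < eps)
    (radius : prob_ge Q (1 - beta)
      [set w | (wasserstein PZ (empirical (Zhat ^~ w)) <= eps%:E)%E]) :
  let obj : lifted R K := (Aobj, bobj) in
  let phi : lifted R K -> R := linner obj in
  prob_ge Q (1 - beta)
    [set w |
      ('E_PZ[phi] <=
         dro_value mu L r eta (fun _ : 'I_1 => obj) (fun _ : 'I_1 => 0%R)
           eps (Zhat ^~ w))%E
      /\
      forall alpha : R, 0 < alpha -> alpha <= 1 ->
      (CVaR PZ alpha phi <=
         dro_value mu L r eta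
           (fun j : 'I_2 => if j == ord0 then alpha^-1 *: obj else 0%R)
           (fun j : 'I_2 =>
              if j == ord0 then (alpha^-1 * (alpha - 1))%R else 1%R)
           eps (Zhat ^~ w))%E].
Proof.
move=> obj phi; have [E [mE EW QE]] := radius; exists E; split => // w /EW W_le.
have mL := @measurable_lifted_set R K mu L r eta.
have mdual := @measurable_psd_dual R K.
pose D := lifted_set mu L r eta `&` @psd_dual R K.
have mD : measurable D by exact: measurableI.
have PD1 : PZ D = 1%E.
  apply: (probability_setI1 mL mdual PZ_on_Z).
  rewrite PZ_pushforward //.
  rewrite [X in P X](_ : _ = setT); first exact: probability_setT.
  by apply/seteqP; split=> // v _; rewrite /= /pep_lift; exact: gram_psd_dual.
have mphi : measurable_fun setT phi by exact: measurable_linner.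
split.
  rewrite unlock; apply: le_ereal_inf_tmp => _ [v feas <-].
  apply: (wasserstein_ball_bound N_ge1 W_le mD PD1 mphi (dro_lambda_ge0 feas)).
  move=> Z i [ZL Zdual].
  by have := dro_weak_duality i ord0 feas ZL Zdual; rewrite mul0r add0r.
move=> alpha alpha_gt0 alpha_le1; apply: le_ereal_inf_tmp => _ [v feas <-].
(* The [t] of the feasible point is the trial value in the infimum defining
   CVaR. *)
pose t := dv_t v.
apply: le_trans (ereal_inf_lbound _) _; first by exists t.
have mexc : measurable_fun setT (fun Z => Num.max (phi Z - t) 0).
  by apply: measurable_maxr => //; apply: measurable_funB.
have lam_ge0 : 0 <= alpha * dv_lambda v.
  by rewrite mulr_ge0 ?(ltW alpha_gt0) // (dro_lambda_ge0 feas).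
(* The bounds for [j = 0] and [j = 1], scaled by [alpha], are those of the two
   arguments of the maximum. *)
have exc_le Z i : D Z -> Num.max (phi Z - t) 0 <=
    alpha * (dv_s v i - t) +
    alpha * dv_lambda v * (lnorm (Z - Zhat i w) - eps).
  move=> [ZL Zdual].
  have h1 := dro_weak_duality i ord0 feas ZL Zdual.
  have h2 := dro_weak_duality i ord_max feas ZL Zdual.
  move: h1 h2; rewrite /= linner0l linnerZl mul1r addr0 -/t -/(phi Z).
  move=> /(ler_wpM2l (ltW alpha_gt0)) h1 /(ler_wpM2l (ltW alpha_gt0)) h2.
  rewrite mulrDr -(mulrA alpha^-1) !mulVKf ?lt0r_neq0 // in h1.
  by rewrite ge_max; apply/andP; split; lra.
rewrite unlock.
have /(lee_wpmul2l (x := (alpha^-1)%:E)) := wasserstein_ball_bound N_ge1 W_le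
  mD PD1 mexc lam_ge0 exc_le.
rewrite lee_fin invr_ge0 ltW // => /(_ isT) /(leeD2l t%:E) /le_trans; apply.
rewrite -EFinM -EFinD lee_fin -mulr_sumr mulrCA mulKf ?lt0r_neq0 //.
by rewrite mean_shift // addrC subrK.
Qed.
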